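(* Let $G$ be a directed graph on vertex set $[n]$ (no loops, multiple edges allowed), and write $$\omega X_G(\mathbf x;q)=\sum_{\alpha\vDash n}c^G_\alpha(q)\frac{\Psi_\alpha(\mathbf x)}{z_\alpha}.$$ Then $c^G_\alpha(q)\in\mathbb N[q]$ (polynomials with nonnegative integer coefficients) for every composition $\alpha$.
   Context: A coloring of $G$ is a map $\kappa:[n]\to\mathbb Z_{>0}$; it is proper if the endpoints of every edge get different colors. $\mathrm{asc}(\kappa)$ is the number of directed edges $(i,j)$ (counted with multiplicity) with $\kappa(i)<\kappa(j)$. The chromatic quasisymmetric function is $X_G(\mathbf x;q)=\sum_{\kappa\text{ proper}}x_{\kappa(1)}\cdots x_{\kappa(n)}q^{\mathrm{asc}(\kappa)}$. $F_{n,S}$ ($S\subseteq[n-1]$) is the fundamental quasisymmetric function $\sum x_{j_1}\cdots x_{j_n}$ over $j_1\le\dots\le j_n$ with $j_i<j_{i+1}$ for $i\in S$; $\omega$ is the linear automorphism with $\omega(F_{n,S})=F_{n,[n-1]\setminus(n-S)}$, $n-S=\{n-s:s\in S\}$, extended coefficientwise in $q$. For compositions: $S_\alpha=\{\alpha_1,\dots,\alpha_1+\dots+\alpha_{\ell-1}\}$, blocks $B_i(\alpha)$ consecutive intervals of sizes $\alpha_i$, $\alpha\le\beta$ iff $S_\beta\subseteq S_\alpha$; $M_\alpha=\sum_{i_1<\dots<i_\ell}x_{i_1}^{\alpha_1}\cdots x_{i_\ell}^{\alpha_\ell}$; $z_\alpha=\prod_i i^{m_i}m_i!$; $\pi(\gamma)=\prod_i(\gamma_1+\dots+\gamma_i)$;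 $\pi(\alpha,\beta)=\prod_i\pi(\alpha^{(i)})$ with $\alpha^{(i)}$ the parts of $\alpha$ whose blocks lie in $B_i(\beta)$; $\Psi_\alpha=z_\alpha\sum_{\beta\ge\alpha}\pi(\alpha,\beta)^{-1}M_\beta$. *)

(* Defs.v *)
From HB Require Import structures.
From mathcomp Require Import all_boot all_order all_algebra.
Set Implicit Arguments. Unset Strict Implicit. Unset Printing Implicit Defensive.
Import Order.TTheory GRing.Theory Num.Theory.
Local Open Scope ring_scope.

(* ---------- Directed graphs on [n] = 'I_n ----------
   A directed graph is a list of directed edges (i,j); multiplicity allowed. *)
Definition loopless (n : nat) (E : seq ('I_n * 'I_n)) : bool :=
  all (fun e => e.1 != e.2) E.

(* colorings with values in positive integers (value 0 never occurs below,
   since monomials only involve positive variable indices) *)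
Definition proper (n : nat) (E : seq ('I_n * 'I_n)) (kappa : 'I_n -> nat) : bool :=
  all (fun e => kappa e.1 != kappa e.2) E.

Definition asc (n : nat) (E : seq ('I_n * 'I_n)) (kappa : 'I_n -> nat) : nat :=
  count (fun e => (kappa e.1 < kappa e.2)%N) E.

(* ---------- Homogeneous degree-n formal power series in x_1, x_2, ... ----------
   A monomial x_{j_1} ... x_{j_n} with j_1 <= ... <= j_n (all j_i >= 1) is encoded by
   the sorted sequence [:: j_1; ...; j_n].  A series is given by its coefficient
   function on such monomials, with coefficients in Q[q] = {poly rat} (q = 'X). *)
Definition is_mono (n : nat) (w : seq nat) : bool :=
  [&& size w == n, sorted leq w & all (fun j => 0 < j)%N w].

(* coefficient of the monomial w in X_G(x;q): sum over proper colorings kappa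
   whose monomial x_{kappa(1)}...x_{kappa(n)} equals w.  All colors of such a
   kappa occur in w, hence are <= sumn w, so the finite range suffices. *)
Definition XGcoef (n : nat) (E : seq ('I_n * 'I_n)) (w : seq nat) : {poly rat} :=
  \sum_(kappa : {ffun 'I_n -> 'I_(sumn w).+1})
     if proper E (fun i => val (kappa i)) &&
        (sort leq [seq val (kappa i) | i <- enum 'I_n] == w)
     then 'X ^+ asc E (fun i => val (kappa i)) else 0.

(* Subsets S of [n-1] are encoded as S : {set 'I_n.-1}, element i encoding i+1. *)
Definition Fcoef (n : nat) (S : {set 'I_n.-1}) (w : seq nat) : bool :=
  [forall i : 'I_n.-1, (i \in S) ==> (nth 0 w i < nth 0 w i.+1)%N].

(* omega on index sets: S |-> [n-1] \ (n - S).  With the encoding above,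
   position p = i+1 goes to n - p, encoded by (n-1)-1-i = rev_ord i. *)
Definition omega_set (n : nat) (S : {set 'I_n.-1}) : {set 'I_n.-1} :=
  ~: [set rev_ord i | i in S].

Fixpoint comps_fuel (fuel m : nat) : seq (seq nat) :=
  if m is 0 then [:: [::]] else
  if fuel is f.+1 then
    flatten [seq [seq k :: b | b <- comps_fuel f (m - k)] | k <- iota 1 m]
  else [::].

Definition compositions (n : nat) : seq (seq nat) := comps_fuel n n.

Definition psum (a : seq nat) (j : nat) : nat := sumn (take j a).

Definition Sset (a : seq nat) : seq nat := [seq psum a j | j <- iota 1 (size a).-1].

Definition comp_le (a b : seq nat) : bool := all (fun s => s \in Sset a) (Sset b).

Definition pi1 (g : seq nat) : nat := \prod_(i < size g) psum g i.+1.

(* alpha^(i): parts of alpha whose blocks B_j(alpha) = (psum a j, psum a (j+1)]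
   lie in B_i(beta) = (psum b i, psum b (i+1)] *)
Definition subcomp (a b : seq nat) (i : nat) : seq nat :=
  [seq nth 0 a j | j <- iota 0 (size a) &
     (psum b i <= psum a j)%N && (psum a j.+1 <= psum b i.+1)%N].

Definition pi2 (a b : seq nat) : nat := \prod_(i < size b) pi1 (subcomp a b i).

Definition zee (a : seq nat) : nat :=
  \prod_(i <- undup a) (i ^ count_mem i a * (count_mem i a)`!)%N.

(* coefficient of monomial w in M_beta = sum_{i_1<...<i_l} x_{i_1}^{b_1}...x_{i_l}^{b_l}:
   for sorted w, 1 iff w = i_1^{b_1} ... i_l^{b_l} with i_1 < ... < i_l
   (necessarily the distinct entries of w). *)
Definition Mcoef (b : seq nat) (w : seq nat) : bool :=
  [&& all (fun x => 0 < x)%N b, size b == size (undup w) &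
      w == flatten [seq nseq p.1 p.2 | p <- zip b (undup w)]].

Definition Psicoef (n : nat) (a : seq nat) (w : seq nat) : rat :=
  (zee a)%:R * \sum_(b <- compositions n | comp_le a b)
                  ((pi2 a b)%:R)^-1 * (Mcoef b w)%:R.

(* Main.v *)
Require Import Defs.
From HB Require Import structures.
From mathcomp Require Import all_boot all_order all_algebra.
From mathcomp Require Import zify ring.
Set Implicit Arguments. Unset Strict Implicit. Unset Printing Implicit Defensive.
Import Order.TTheory GRing.Theory Num.Theory.
Local Open Scope ring_scope.

(** Functions on subsets of the vertex set form an algebra under the convolution
    [(f * g)(V) = \sum_(A \subset V) q^e(A, V \ A) f(A) g(V \ A)], where [e] counts
    the edges from [A] to [V \ A].  Let [s_k] be the indicator of stable sets of size
    [k], and let [h] be the inverse of the signed indicator of all stable sets, with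
    homogeneous parts [h_k]; [h] is the [q]-count of acyclic orientations.  The
    coefficient of [X_G] at a monomial of type [b] is [s_b1 * ... * s_bl], and by
    Moebius inversion that of [omega X_G] is [h_bl * ... * h_b1], both evaluated at
    the full vertex set.  Let [g(V)] be the [q]-count of acyclic orientations of [V]
    with a unique sink.  Marking a vertex [v] and splitting off the vertices that
    reach it gives [k h_k = \sum_j g_j * h_(k - j)], so [h_k] is the sum of
    [g_al * ... * g_a1 / pi(a)] over the compositions [a] of [k].  Hence [c_a] is
    [g_al * ... * g_a1] at the full vertex set, and [g] has coefficients in [N[q]]
    because peeling off the set of all sinks is a subtraction-free recursion. *)

(** * Compositions and their partial sums *)

Lemma comps_fuelS f m : comps_fuel f.+1 m.+1 =
  flatten [seq [seq k :: b | b <- comps_fuel f (m.+1 - k)] | k <- iota 1 m.+1].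
Proof. by []. Qed.

(** Parts are positive, so each unit of fuel pays for a drop of [m] by at least one. *)
Lemma comps_fuelE f m : (m <= f)%N -> comps_fuel f m = compositions m.
Proof.
rewrite /compositions.
have H : forall N f f' m, (m <= N)%N -> (m <= f)%N -> (m <= f')%N ->
    comps_fuel f m = comps_fuel f' m; last by move=> mf; apply: (H m).
elim=> [|N IH] {}f f' {}m hN hf hf'.
  by have -> : m = 0%N by [lia]; case: (f) (f') => [|?] [|?].
case: m f f' hN hf hf' => [|m] [|f] [|f'] // hN hf hf'.
rewrite !comps_fuelS; congr flatten; apply/eq_in_map => k; rewrite mem_iota => hk.
congr map; apply: IH; lia.
Qed.

Lemma compositionsS n : compositions n.+1 =
  flatten [seq [seq k :: b | b <- compositions (n.+1 - k)] | k <- iota 1 n.+1].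
Proof.
rewrite {1}/compositions comps_fuelS; congr flatten.
apply/eq_in_map => k; rewrite mem_iota => hk; congr map; apply: comps_fuelE; lia.
Qed.

Lemma mem_compositions n a :
  (a \in compositions n) = (sumn a == n) && all (ltn 0) a.
Proof.
elim/ltn_ind: n a => -[|n] IH a.
  rewrite inE; case: a => [|k a] //=; symmetry; apply/negbTE; lia.
rewrite compositionsS; apply/idP/andP => [/flatten_mapP[k kn /mapP[b hb ->]]|].
  move: kn hb; rewrite mem_iota => kn; rewrite IH; last lia.
  case/andP=> /eqP sb ab; rewrite /= ab sb; lia.
case: a => [[]//|k a [/eqP sa pa]].
have /andP[k0 {}pa] : (0 < k)%N && all (ltn 0) a := pa.
have {}sa : (k + sumn a)%N = n.+1 := sa.
apply/flatten_mapP; exists k; first by rewrite mem_iota; lia.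
by apply/mapP; exists a => //; rewrite IH ?pa ?andbT; lia.
Qed.

Lemma compositions_uniq n : uniq (compositions n).
Proof.
elim/ltn_ind: n => -[|n] IH //; rewrite compositionsS.
set l := iota 1 n.+1.
have ul : uniq l by apply: iota_uniq.
have hl k : k \in l -> (0 < k)%N by rewrite mem_iota; lia.
elim: l ul hl => //= k l IHl /andP[kl ul] hl.
rewrite cat_uniq IHl //; last by move=> j jl; apply: hl; rewrite inE jl orbT.
rewrite andbT map_inj_uniq; last by move=> ? ? [].
rewrite IH ?andTb; last by have := hl k (mem_head _ _); lia.
apply/hasPn => x /flatten_mapP[j jl /mapP[b _ ->]].
by apply/mapP => -[b' _ [ekj _]]; rewrite -ekj jl in kl.
Qed.

(** Reversal turns the recursion on the first part into one on the last part. *)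
Lemma perm_compositions_rev n :
  perm_eq [seq rev a | a <- compositions n] (compositions n).
Proof.
apply: uniq_perm; rewrite ?compositions_uniq //.
  by rewrite map_inj_uniq ?compositions_uniq //; exact: (can_inj revK).
move=> a; rewrite -[a in LHS]revK mem_map; last exact: (can_inj revK).
by rewrite !mem_compositions sumn_rev all_rev.
Qed.

Section CompositionSums.
Variables (V : nmodType).
Implicit Types (F : seq nat -> V).

Lemma big_compositions_cons n F :
  \sum_(a <- compositions n.+1) F a =
  \sum_(k < n.+1) \sum_(b <- compositions (n - k)) F (k.+1 :: b).
Proof.
rewrite compositionsS big_flatten big_map -[1%N]addn0 iotaDl big_map.
rewrite -[n.+1]subn0 -/(index_iota 0 n.+1) subn0 big_mkord.
by apply: eq_bigr => k _; rewrite big_map add1n subSS.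
Qed.

Lemma big_compositions_rcons n F :
  \sum_(a <- compositions n.+1) F a =
  \sum_(k < n.+1) \sum_(b <- compositions (n - k)) F (rcons b k.+1).
Proof.
rewrite -(perm_big _ (perm_compositions_rev n.+1)) big_map big_compositions_cons.
apply: eq_bigr => k _.
symmetry; rewrite -(perm_big _ (perm_compositions_rev (n - k))) big_map.
by apply: eq_bigr => b _; rewrite rev_cons.
Qed.
End CompositionSums.

(** Unlike [Sset], this list keeps the total as its last entry, so concatenation merely appends a
    shifted copy. *)
Definition psums (a : seq nat) : seq nat := scanl addn 0%N a.

Lemma scanl_addn x a : scanl addn x a = [seq (x + y)%N | y <- psums a].
Proof.
rewrite /psums; elim: a x => //= k a IH x.
rewrite add0n IH (IH k) -map_comp; congr (_ :: _).
by apply: eq_map => y /=; rewrite addnA.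
Qed.

Lemma psums_cons k a : psums (k :: a) = k :: [seq (k + y)%N | y <- psums a].
Proof. by rewrite /psums /= add0n scanl_addn. Qed.

Lemma psums_cat a b : psums (a ++ b) = psums a ++ [seq (sumn a + y)%N | y <- psums b].
Proof.
elim: a => [|k a IH]; first by rewrite map_id_in // => y.
rewrite cat_cons !psums_cons IH cat_cons map_cat -map_comp; congr (_ :: _ ++ _).
by apply: eq_map => y /=; rewrite addnA.
Qed.

Lemma psumsE a : psums a = [seq psum a j | j <- iota 1 (size a)].
Proof.
elim: a => // k a IH.
rewrite psums_cons IH [size _]/= -[iota 1 _.+1]/(1%N :: iota (1 + 1) _) iotaDl.
by rewrite map_cons -!map_comp /psum /= take0 addn0; congr (_ :: _).
Qed.

Lemma mem_psums a y : all (ltn 0) a -> y \in psums a -> (0 < y <= sumn a)%N.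
Proof.
elim: a y => //= k a IH y /andP[k0 pa]; rewrite psums_cons inE.
case/orP=> [/eqP->|/mapP[z /IH - /(_ pa) hz ->]]; lia.
Qed.

Lemma sumn_psums a : a != [::] -> sumn a \in psums a.
Proof.
case: a => // k a _; elim: a k => [|l a IH] k; first by rewrite /= addn0 mem_head.
by rewrite psums_cons inE; apply/orP; right; apply: (map_f (addn k) (IH l)).
Qed.

Lemma psums_sorted a : all (ltn 0) a -> sorted ltn (psums a).
Proof.
elim: a => // k a IH /andP[k0 pa]; rewrite psums_cons [sorted _ _]/=.
have := IH pa; have := @mem_psums a ^~ pa.
case: (psums a) => //= y s hy p; rewrite (@path_map _ _ (addn k)).
apply/andP; split; first by have := hy y (mem_head _ _); lia.
by apply: sub_path p => u v; rewrite /= ltn_add2l.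
Qed.

Lemma psums_inj : injective psums.
Proof.
elim=> [|k a IH] [|l b] //; rewrite ?psums_cons // => -[-> /inj_map e].
by rewrite (IH b) //; apply: e; exact: addnI.
Qed.

(** The total [n] drops out, since [i.+1 < n] for every index; what remains is $S_\alpha$ in the
    shifted encoding of [Fcoef]. *)
Definition cset (n : nat) (a : seq nat) : {set 'I_n.-1} :=
  [set i : 'I_n.-1 | i.+1 \in psums a].

Lemma mem_Sset n a s : a \in compositions n ->
  (s \in Sset a) = (s < n)%N && (s \in psums a).
Proof.
rewrite mem_compositions => /andP[/eqP sa pa].
case: (lastP a) sa pa => [|b k]; first by rewrite andbF.
rewrite sumn_rcons all_rcons => sa /= /andP[k0 pb].
have e : Sset (rcons b k) = psums b.
  rewrite /Sset psumsE size_rcons /=; apply/eq_in_map => j.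
  by rewrite mem_iota /psum => hj; rewrite -cats1 takel_cat //; lia.
rewrite e -cats1 psums_cat mem_cat /= inE.
case: (boolP (s \in psums b)) => [/mem_psums-/(_ pb)|_] /=; lia.
Qed.

Lemma comp_le_cset n a b : a \in compositions n -> b \in compositions n ->
  comp_le a b = (cset n b \subset cset n a).
Proof.
move=> ha hb; apply/allP/subsetP => [H i|H s].
  have hi : (i.+1 < n)%N by move: (ltn_ord i); lia.
  by rewrite !inE => ib; have := H i.+1; rewrite !(mem_Sset _ ha, mem_Sset _ hb) hi ib; apply.
rewrite !(mem_Sset _ ha, mem_Sset _ hb) => /andP[sn sb].
have /andP[s0 _] : (0 < s <= sumn b)%N.
  by apply: mem_psums => //; move: hb; rewrite mem_compositions => /andP[].
have hs : (s.-1 < n.-1)%N by lia.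
by have := H (Ordinal hs); rewrite !inE /= prednK // => /(_ sb) ->; rewrite sn.
Qed.

(** The partial sums determine the composition, and they form a strictly increasing list, which is
    determined by its members. *)
Lemma cset_inj n : {in compositions n &, injective (cset n)}.
Proof.
move=> a b; rewrite !mem_compositions => /andP[/eqP sa pa] /andP[/eqP sb pb] e.
apply: psums_inj; apply: (irr_sorted_eq ltn_trans ltnn) (psums_sorted pa) (psums_sorted pb) _.
(* The only entry of [psums c] that [cset] misses is [n], present exactly when [n > 0]. *)
have H c : sumn c = n -> all (ltn 0) c -> forall s,
   (s \in psums c) = ((s == n) && (0 < n)%N) || [exists i in cset n c, i.+1 == s].
  move=> sc pc s; apply/idP/orP => [hs|[/andP[/eqP-> n0]|/exists_inP[i]]].
  - have := mem_psums pc hs; rewrite sc => /andP[s0]; rewrite leq_eqVlt.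
    case/orP=> [/eqP|] sn; [by left; rewrite -sn eqxx|right].
    have hi : (s.-1 < n.-1)%N by lia.
    by apply/exists_inP; exists (Ordinal hi); rewrite ?inE /= prednK.
  - by rewrite -sc; apply: sumn_psums; move: n0; rewrite -sc; case: (c).
  - by rewrite inE => hi /eqP<-.
by move=> s; rewrite (H a) // (H b) // e.
Qed.

(** * The convolution algebra of set functions *)

Definition cross (n : nat) (E : seq ('I_n * 'I_n)) (A B : {set 'I_n}) : nat :=
  count (fun e => (e.1 \in A) && (e.2 \in B)) E.

Section Cross.
Variables (n : nat) (E : seq ('I_n * 'I_n)).
Implicit Types A B C : {set 'I_n}.

Lemma crossUl A B C : [disjoint A & B] ->
  cross E (A :|: B) C = (cross E A C + cross E B C)%N.
Proof.
move=> dAB; rewrite /cross -count_predUI [X in (_ = _ + X)%N](_ : _ = 0%N).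
  by rewrite addn0; apply: eq_count => e; rewrite /= inE andb_orl.
rewrite -[RHS](count_pred0 E); apply: eq_count => e /=.
by case: (boolP (e.1 \in A)) => //= /(disjointFr dAB) ->; rewrite andbF.
Qed.

Lemma crossUr A B C : [disjoint B & C] ->
  cross E A (B :|: C) = (cross E A B + cross E A C)%N.
Proof.
move=> dBC; rewrite /cross -count_predUI [X in (_ = _ + X)%N](_ : _ = 0%N).
  by rewrite addn0; apply: eq_count => e; rewrite /= inE andb_orr.
rewrite -[RHS](count_pred0 E); apply: eq_count => e /=.
by case: (boolP (e.2 \in B)) => [/(disjointFr dBC) ->|]; rewrite ?andbF.
Qed.

Lemma cross0l A : cross E set0 A = 0%N.
Proof. by rewrite /cross -(count_pred0 E); apply: eq_count => e; rewrite /= inE. Qed.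

Lemma cross0r A : cross E A set0 = 0%N.
Proof. by rewrite /cross -(count_pred0 E); apply: eq_count => e; rewrite /= inE andbF. Qed.
End Cross.

(* [E] is a phantom parameter selecting the convolution product. *)
Definition setalg (n : nat) (E : seq ('I_n * 'I_n)) := {ffun {set 'I_n} -> {poly rat}}.
HB.instance Definition _ n E := GRing.Lmodule.on (@setalg n E).

Section SetAlgebra.
Variables (n : nat) (E : seq ('I_n * 'I_n)).
Implicit Types (A B C V : {set 'I_n}) (f g : setalg E).

Definition setmul f g : setalg E :=
  [ffun V : {set 'I_n} => \sum_(A : {set 'I_n} | A \subset V)
     'X^(cross E A (V :\: A)) * f A * g (V :\: A)].

Definition setone : setalg E := [ffun V : {set 'I_n} => (V == set0)%:R].

Lemma setmul1 : left_id setone setmul.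
Proof.
move=> f; apply/ffunP => V; rewrite ffunE (bigD1 set0) ?sub0set //= ffunE eqxx.
rewrite cross0l expr0 !mul1r setD0 big1 ?addr0 // => A /andP[_ /negbTE nA].
by rewrite ffunE nA mulr0 mul0r.
Qed.

Lemma setmulr1 : right_id setone setmul.
Proof.
move=> f; apply/ffunP => V; rewrite ffunE (bigD1 V) //= ffunE setDv eqxx.
rewrite cross0r expr0 mul1r mulr1 big1 ?addr0 // => A /andP[sA nA].
by rewrite ffunE setD_eq0 [V \subset A]negbTE ?mulr0 // -[_ \subset _]andTb -sA -eqEsubset.
Qed.

Lemma setmulDl : left_distributive setmul +%R.
Proof.
move=> f g h; apply/ffunP => V; rewrite !ffunE -big_split; apply: eq_bigr => A _.
by rewrite ffunE mulrDr mulrDl.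
Qed.

Lemma setmulDr : right_distributive setmul +%R.
Proof.
move=> f g h; apply/ffunP => V; rewrite !ffunE -big_split; apply: eq_bigr => A _.
by rewrite ffunE mulrDr.
Qed.

(** Both sides sum over ordered partitions $V = A \sqcup B \sqcup C$, with $q$ counting the edges
    from an earlier block to a later one. *)
Lemma setmulA : associative setmul.
Proof.
move=> f g h; apply/ffunP => V; rewrite !ffunE.
under eq_bigr => A _ do rewrite ffunE big_distrr /=.
under [RHS]eq_bigr => A _ do rewrite ffunE big_distrr big_distrl /=.
rewrite [RHS](exchange_big_dep (fun A : {set 'I_n} => A \subset V)) /=; last first.
  by move=> A B AV BA; apply: subset_trans BA AV.
apply: eq_bigr => A AV.
(* For fixed [A], the outer set on the right is replaced by its part outside [A], the middle
   block. *)
rewrite [RHS](reindex_onto (fun B => A :|: B) (fun B => B :\: A)) /=; last first.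
  by move=> B /andP[_ AB]; rewrite setDE setUIr setUCr setIT; apply/setUidPr.
apply: eq_big => [B|B].
  rewrite subsetUl andbT subUset AV /= subsetD; congr (_ && _).
  by rewrite setDUl setDv set0U; apply/setDidPl/eqP.
rewrite subsetD => /andP[BV dBA].
have -> : (A :|: B) :\: A = B by rewrite setDUl setDv set0U; apply/setDidPl.
have e1 : cross E A (V :\: A) = (cross E A B + cross E A (V :\: (A :|: B)))%N.
  rewrite -crossUr; last first.
    rewrite -setI_eq0; apply/eqP/setP => i; rewrite !inE negb_or.
    by case: (i \in B); rewrite ?andbF.
  congr cross; apply/setP => i; rewrite !inE negb_or.
  by case: (boolP (i \in B)) => iB; rewrite ?(disjointFr dBA iB) ?(subsetP BV _ iB) ?andbT.
rewrite e1 crossUl 1?disjoint_sym // !exprD -setDDl.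
by rewrite -!mulrA; ring.
Qed.

Lemma setone_neq0 : setone != 0.
Proof.
apply/eqP => /ffunP/(_ set0); rewrite !ffunE eqxx => /eqP; apply/negP; exact: oner_neq0.
Qed.
End SetAlgebra.

HB.instance Definition _ n E := GRing.Zmodule_isNzRing.Build (@setalg n E)
  (@setmulA n E) (@setmul1 n E) (@setmulr1 n E) (@setmulDl n E) (@setmulDr n E)
  (@setone_neq0 n E).

Section SetAlgebraTheory.
Variables (n : nat) (E : seq ('I_n * 'I_n)).
Implicit Types (A B C V N S : {set 'I_n}) (f g : setalg E).

Lemma setalgME f g V : (f * g) V = \sum_(A : {set 'I_n} | A \subset V)
     'X^(cross E A (V :\: A)) * f A * g (V :\: A).
Proof. by rewrite [LHS]ffunE. Qed.

Lemma setalg1E V : (1 : setalg E) V = (V == set0)%:R.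
Proof. by rewrite [LHS]ffunE. Qed.

Lemma setalg_scaleAl (k : rat) f g : k *: (f * g) = (k *: f) * g.
Proof.
apply/ffunP => V; rewrite ffunE !setalgME scaler_sumr; apply: eq_bigr => A _.
by rewrite ffunE -scalerAr -!scalerAl.
Qed.

Lemma setalg_scaleAr (k : rat) f g : k *: (f * g) = f * (k *: g).
Proof.
apply/ffunP => V; rewrite ffunE !setalgME scaler_sumr; apply: eq_bigr => A _.
by rewrite ffunE -!scalerAr.
Qed.
End SetAlgebraTheory.

HB.instance Definition _ n E := GRing.Lmodule_isLalgebra.Build rat (@setalg n E)
  (@setalg_scaleAl n E).
HB.instance Definition _ n E := GRing.Lalgebra_isAlgebra.Build rat (@setalg n E)
  (@setalg_scaleAr n E).

(** * Sums over refinements *)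

Lemma compositions_pos n a : a \in compositions n -> all (ltn 0) a.
Proof. by rewrite mem_compositions => /andP[]. Qed.

Lemma compositions_sum n a : a \in compositions n -> sumn a = n.
Proof. by rewrite mem_compositions => /andP[/eqP]. Qed.

Lemma size_compositions n a : a \in compositions n -> (size a <= n)%N.
Proof.
rewrite mem_compositions => /andP[/eqP<- {n}].
elim: a => //= k a IH /andP[k0 /IH]; lia.
Qed.

Lemma comp_leE n a b : a \in compositions n -> b \in compositions n ->
  comp_le a b = all (mem (psums a)) (psums b).
Proof.
move=> ha hb; apply/allP/allP => H s.
  move=> sb; have /andP[s0] := mem_psums (compositions_pos hb) sb.
  rewrite (compositions_sum hb) leq_eqVlt => /orP[/eqP|] sn.
    rewrite /= sn -(compositions_sum ha); apply: sumn_psums.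
    by case: (a) (compositions_sum ha) => //= e; lia.
  by have := H s; rewrite (mem_Sset _ ha) (mem_Sset _ hb) sn sb; apply.
by rewrite (mem_Sset _ ha) (mem_Sset _ hb) => /andP[-> /H].
Qed.

(** The sum [k] is matched by the end of [a1]; the later partial sums of [k :: b] exceed [k], so
    only [a] can match them. *)
Lemma comp_le_cat k n a1 a b : (0 < k)%N -> a1 \in compositions k ->
  a \in compositions n -> b \in compositions n ->
  comp_le (a1 ++ a) (k :: b) = comp_le a b.
Proof.
move=> k0 ha1 ha hb.
have s1 := compositions_sum ha1; have p1 := compositions_pos ha1.
rewrite (comp_leE ha hb) (@comp_leE (k + n)); first last.
- by move: hb; rewrite !mem_compositions /= k0 eqn_add2l.
- rewrite mem_compositions sumn_cat all_cat p1 (compositions_pos ha) s1.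
  by rewrite (compositions_sum ha) eqxx.
rewrite psums_cat psums_cons [all _ _]/= mem_cat {1}s1 -{1}s1 sumn_psums /=; last first.
  by case: (a1) s1 => //= e; lia.
rewrite all_map; apply: eq_in_all => y yb.
have /andP[y0 _] := mem_psums (compositions_pos hb) yb.
rewrite /= mem_cat s1 mem_map; last exact: addnI.
case: (boolP (_ \in psums a1)) => // /(mem_psums p1); rewrite s1; lia.
Qed.

Lemma cat_eq_sumn (a1 a1' a a' : seq nat) : all (ltn 0) a1 -> all (ltn 0) a1' ->
  sumn a1 = sumn a1' -> a1 ++ a = a1' ++ a' -> a1 = a1'.
Proof.
elim: a1 a1' => [|k a1 IH] [|k' a1'] //=.
- by move=> _ /andP[]; lia.
- by move=> /andP[]; lia.
move=> /andP[_ p] /andP[_ p'] s [ek e]; subst k'.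
by congr (_ :: _); apply: IH => //; apply: (addnI s).
Qed.

(** A refinement of [k :: b] has [k] among its partial sums, and cutting there splits it
    uniquely. *)
Lemma perm_refinements k n b : (0 < k)%N -> b \in compositions n ->
  perm_eq [seq a <- compositions (k + n) | comp_le a (k :: b)]
    [seq a1 ++ a | a1 <- compositions k, a <- [seq a <- compositions n | comp_le a b]].
Proof.
move=> k0 hb; apply: uniq_perm.
- by rewrite filter_uniq ?compositions_uniq.
- apply: allpairs_uniq; rewrite ?filter_uniq ?compositions_uniq //.
  move=> _ _ /allpairsP[[a1 a] [h1 _ ->]] /allpairsP[[a1' a'] [h1' _ ->]] /= e.
  have e1 : a1 = a1'.
    apply: cat_eq_sumn e; rewrite ?(compositions_pos h1) ?(compositions_pos h1') //.
    by rewrite (compositions_sum h1) (compositions_sum h1').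
  by move: e; rewrite e1 => /eqP; rewrite eqseq_cat // eqxx /= => /eqP->.
have hkb : k :: b \in compositions (k + n).
  by move: hb; rewrite !mem_compositions /= k0 eqn_add2l.
move=> a; apply/idP/idP.
  rewrite mem_filter => /andP[le ha].
  have : k \in psums a.
    by move: le; rewrite (comp_leE ha hkb) psums_cons /= => /andP[].
  rewrite psumsE => /mapP[j _ ej].
  have := ha; rewrite mem_compositions -{1 2}(cat_take_drop j a) sumn_cat all_cat.
  rewrite -/(psum a j) -ej eqn_add2l => /and3P[s2 p1 p2].
  have h1 : take j a \in compositions k by rewrite mem_compositions p1 andbT ej.
  have h2 : drop j a \in compositions n by rewrite mem_compositions p2 s2.
  apply/allpairsP; exists (take j a, drop j a); split => //=; rewrite ?cat_take_drop //.
  by rewrite mem_filter h2 andbT -(comp_le_cat k0 h1 h2 hb) cat_take_drop.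
case/allpairsP=> -[a1 a'] /= [h1]; rewrite mem_filter => /andP[le h2] ->.
rewrite mem_filter (comp_le_cat k0 h1 h2 hb) le mem_compositions sumn_cat all_cat.
rewrite (compositions_sum h1) (compositions_sum h2) eqxx.
by rewrite (compositions_pos h1) (compositions_pos h2).
Qed.

Section ReverseProduct.
Variable A : nzRingType.
Implicit Type u : nat -> A.

(** The convolution is not commutative; the reversed order is the one in which $\omega X_G$ presents
    its factors. *)
Fixpoint rprod u (a : seq nat) : A := if a is k :: a' then rprod u a' * u k else 1.

Lemma rprod_cat u a b : rprod u (a ++ b) = rprod u b * rprod u a.
Proof. by elim: a => [|k a IH] /=; rewrite ?mulr1 // IH mulrA. Qed.

Lemma rprod_rcons u a k : rprod u (rcons a k) = u k * rprod u a.
Proof. by rewrite -cats1 rprod_cat /= mul1r. Qed.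
End ReverseProduct.

Section Refinement.
Variables (R : comNzRingType) (A : algType R).
Variables (wt : seq nat -> seq nat -> R) (wt1 : seq nat -> R) (u h : nat -> A).
Hypothesis wt_nil : wt [::] [::] = 1.
Hypothesis wt_cat : forall k n a1 a b, (0 < k)%N -> a1 \in compositions k ->
  a \in compositions n -> b \in compositions n ->
  wt (a1 ++ a) (k :: b) = wt1 a1 * wt a b.
Hypothesis h_def : forall k, (0 < k)%N ->
  h k = \sum_(a <- compositions k) wt1 a *: rprod u a.

(** Expanding each factor of [rprod h b] over compositions of its part and concatenating gives every
    refinement of [b] once. Used with signs and with $1/\pi$ as weights. *)
Lemma sum_refinements n b : b \in compositions n ->
  \sum_(a <- compositions n | comp_le a b) wt a b *: rprod u a = rprod h b.
Proof.
elim: b n => [|k b IH] n hb.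
  by rewrite -(compositions_sum hb) /= big_cons big_nil /= wt_nil scale1r addr0.
have := hb; rewrite mem_compositions /= => /andP[/eqP sn /andP[k0 pb]].
have hb' : b \in compositions (n - k) by rewrite mem_compositions pb andbT -sn addKn.
have en : n = (k + (n - k))%N by lia.
rewrite [in LHS]en -big_filter (perm_big _ (perm_refinements k0 hb')) big_allpairs_dep.
rewrite /= -(IH _ hb') h_def // exchange_big /= big_filter big_distrl /=.
rewrite big_seq_cond [RHS]big_seq_cond; apply: eq_bigr => a /andP[ha _].
rewrite big_distrr /=; apply: eq_big_seq => a1 ha1.
by rewrite (wt_cat k0 ha1 ha hb') rprod_cat -scalerAl -scalerAr scalerA mulrC.
Qed.
End Refinement.

(** * Solving recursions by sums over compositions *)

Section Transition.
Variables (F : numFieldType) (A : algType F).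
Implicit Types (s h g : nat -> A).

(** Iterating the recursion, a part [j.+1] contributes the sign $(-1)^j$, so the exponents add up to
    [k - size a]. *)
Lemma homogeneous_elementary s h : h 0%N = 1 ->
  (forall k, h k.+1 = \sum_(j < k.+1) (-1) ^+ j *: (h (k - j)%N * s j.+1)) ->
  forall k, h k = \sum_(a <- compositions k) (-1) ^+ (k - size a) *: rprod s a.
Proof.
move=> h0 hS; elim/ltn_ind => -[|k] IH.
  by rewrite h0 big_cons big_nil /= scale1r addr0.
rewrite hS big_compositions_cons; apply: eq_bigr => j _.
rewrite IH; last by rewrite ltnS leq_subr.
rewrite big_distrl scaler_sumr; apply: eq_big_seq => b hb.
rewrite /= -scalerAl scalerA -exprD subSS; congr (_ ^+ _ *: _).
by rewrite addnBA ?(size_compositions hb) ?subnKC // -ltnS.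
Qed.

Lemma psum_rcons b j k : psum (rcons b k) j.+1 =
  if (j.+1 <= size b)%N then psum b j.+1 else (sumn b + k)%N.
Proof.
rewrite /psum -cats1; case: (leqP j.+1 (size b)) => hj; first by rewrite takel_cat.
by rewrite take_oversize ?sumn_cat /= ?addn0 ?size_cat ?addn1.
Qed.

Lemma pi1_rcons b k : pi1 (rcons b k) = (pi1 b * (sumn b + k))%N.
Proof.
rewrite /pi1 size_rcons big_ord_recr /= psum_rcons ltnn; congr (_ * _)%N.
by apply: eq_bigr => i _; rewrite psum_rcons ltn_ord.
Qed.

(** The hypothesis is a noncommutative Newton identity. The last part is peeled off because the last
    factor of [pi1] is the whole sum, which cancels the scalar [k.+1]. *)
Lemma homogeneous_power g h : h 0%N = 1 ->
  (forall k, k.+1%:R *: h k.+1 = \sum_(j < k.+1) g j.+1 * h (k - j)%N) ->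
  forall k, h k = \sum_(a <- compositions k) (pi1 a)%:R^-1 *: rprod g a.
Proof.
move=> h0 hS; elim/ltn_ind => -[|k] IH.
  by rewrite h0 big_cons big_nil /pi1 big_ord0 /= invr1 scale1r addr0.
have nz : (k.+1%:R : F) != 0 by rewrite pnatr_eq0.
apply: (scalerI nz); rewrite hS big_compositions_rcons scaler_sumr.
apply: eq_bigr => j _; rewrite IH; last by rewrite ltnS leq_subr.
rewrite big_distrr scaler_sumr; apply: eq_big_seq => b hb.
rewrite /= rprod_rcons -scalerAr scalerA pi1_rcons (compositions_sum hb).
have -> : (k - j + j.+1 = k.+1)%N by have := ltn_ord j; lia.
by rewrite natrM invfM mulrC divfK.
Qed.
End Transition.

(** * Stable sets and acyclic orientations *)

(** If [A] differs from [B], toggling a fixed element of [B :\: A] is a sign-reversing involution on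
    the interval. *)
Lemma sum_sign_interval (R : pzRingType) (T : finType) (A B : {set T}) : A \subset B ->
  \sum_(S : {set T} | (A \subset S) && (S \subset B)) (-1) ^+ #|S| =
  (A == B)%:R * (-1) ^+ #|A| :> R.
Proof.
move=> AB; have [<-|nAB] := eqVneq A B.
  rewrite (big_pred1 A) ?mul1r // => S.
  by rewrite /= andbC -eqEsubset.
have /set0Pn[x] : B :\: A != set0.
  by apply: contraNneq nAB => /eqP; rewrite setD_eq0 => BA; rewrite eqEsubset AB.
rewrite inE mul0r => /andP[xA xB].
rewrite (bigID (fun S : {set T} => x \in S)) /=.
rewrite (reindex_onto (fun S => x |: S) (fun S => S :\ x)) /=; last first.
  by move=> S /andP[_ xS]; rewrite setD1K.
rewrite (eq_bigl (fun S : {set T} => (A \subset S) && (S \subset B) && (x \notin S))).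
  rewrite -big_split big1 //= => S /andP[_ xS].
  by rewrite cardsU1 xS exprS mulN1r addNr.
move=> S; rewrite setU11 andbT subUset sub1set xB /=.
have [xS|xS] := boolP (x \in S).
  rewrite andbF; apply/negbTE; rewrite negb_and orbC; apply/orP; left.
  by apply: contraTneq xS => <-; rewrite !inE eqxx.
rewrite setU1K // eqxx !andbT; congr (_ && _).
rewrite -subDset (_ : A :\ x = A) //.
by apply/setDidPl; rewrite disjoint_sym disjoints1.
Qed.

Section Elements.
Variables (n : nat) (E : seq ('I_n * 'I_n)).
Implicit Types (A B C V N S U : {set 'I_n}) (f g : setalg E) (k : nat).

Definition stable A : bool := cross E A A == 0%N.

Definition restr N f : setalg E := [ffun V : {set 'I_n} => (V \subset N)%:R * f V].

Definition grade k f : setalg E := [ffun V : {set 'I_n} => (#|V| == k)%:R * f V].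

Lemma restr1 N : restr N 1 = 1.
Proof.
apply/ffunP => V; rewrite ffunE setalg1E.
by have [->|_] := eqVneq V set0; rewrite ?sub0set ?mulr1 ?mulr0.
Qed.

(** A set lies in [N] exactly when both pieces of any splitting of it do. *)
Lemma restrM N f g : restr N (f * g) = restr N f * restr N g.
Proof.
apply/ffunP => V; rewrite ffunE !setalgME big_distrr; apply: eq_bigr => A AV /=.
rewrite !ffunE.
have -> : (V \subset N) = (A \subset N) && (V :\: A \subset N).
  by rewrite -subUset setDE setUIr setUCr setIT (setUidPr AV).
by case: (A \subset N); case: (V :\: A \subset N); rewrite /= !(mul0r, mulr0, mul1r).
Qed.

Lemma gradeM k f g : grade k (f * g) = \sum_(j < k.+1) grade j f * grade (k - j)%N g.
Proof.
apply/ffunP => V; rewrite ffunE sum_ffunE.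
under [RHS]eq_bigr do rewrite setalgME.
rewrite exchange_big setalgME big_distrr; apply: eq_bigr => A AV /=.
have cA : (#|V| = #|A| + #|V :\: A|)%N by rewrite -(cardsID A V) (setIidPr AV).
under eq_bigr do rewrite !ffunE.
have [eV|nV] := eqVneq #|V| k.
  have hA : (#|A| < k.+1)%N by lia.
  rewrite (bigD1 (Ordinal hA)) //= eqxx big1 => [|j].
    have -> : (k - #|A|)%N = #|V :\: A| by rewrite -eV cA addKn.
    by rewrite eqxx !mul1r addr0.
  by rewrite -val_eqE /= eq_sym => /negbTE->; rewrite mul0r mulr0 mul0r.
rewrite mul0r big1 // => j _; have := ltn_ord j.
case: eqP => [eA|_]; last by rewrite mul0r mulr0 mul0r.
case: eqP => [eB|_]; last by rewrite mul0r mulr0.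
by move=> ?; exfalso; move/eqP: nV; apply; lia.
Qed.

(** A product of [k] such factors would need [k] disjoint nonempty subsets of [V]. *)
Lemma setalg_nilpotent f V k : f set0 = 0 -> (#|V| < k)%N -> (f ^+ k) V = 0.
Proof.
move=> f0; elim: k V => // k IH V hV; rewrite exprS setalgME big1 // => A AV.
have [->|A0] := eqVneq A set0; first by rewrite f0 mulr0 mul0r.
rewrite IH ?mulr0 //; have := cardsID A V; rewrite (setIidPr AV).
by move: A0; rewrite -card_gt0; lia.
Qed.

(** This is $\sum_k (-1)^k s_k$. *)
Definition melt : setalg E :=
  [ffun V : {set 'I_n} => (stable V)%:R * (-1) ^+ #|V|].

(* The inverse of [melt], as a geometric series: [1 - melt] is nilpotent. *)
Definition htot : setalg E := \sum_(i < n.+1) (1 - melt) ^+ i.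

Lemma melt0 : melt set0 = 1.
Proof. by rewrite ffunE /stable cross0l eqxx cards0 mul1r. Qed.

Lemma melt_htot : melt * htot = 1.
Proof.
have nil : (1 - melt) ^+ n.+1 = 0.
  apply/ffunP => V; rewrite [RHS]ffunE; apply: setalg_nilpotent.
    by rewrite ffunE setalg1E eqxx ffunE melt0 subrr.
  by rewrite ltnS -[X in (_ <= X)%N]card_ord max_card.
have := subrX1 (1 - melt) n.+1; rewrite nil sub0r addrAC subrr sub0r -/htot mulNr.
by move/oppr_inj.
Qed.

(** As a polynomial in [1 - melt], [htot] commutes with [melt]. *)
Lemma htot_melt : htot * melt = 1.
Proof.
rewrite -[RHS]melt_htot; apply: commr_sym; apply: commr_sum => i _.
by apply: commrX; apply: commrB; [exact: commr1|].
Qed.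

Lemma htot0 : htot set0 = 1.
Proof.
have := congr1 (fun f : setalg E => f set0) htot_melt.
rewrite setalg1E setalgME eqxx (big_pred1 set0) => [|A]; last exact: subset0.
by rewrite cross0l setD0 melt0 mul1r mulr1.
Qed.

(* Weighted count of the acyclic orientations all of whose sinks lie in [N]. *)
Definition sinks N : setalg E := htot * restr (~: N) melt.

(** [melt] and [htot] stay inverse after restriction. Combinatorially, an acyclic orientation splits
    into the vertices that reach [N] and the rest, which avoids [N]. *)
Lemma htot_sinks N : htot = sinks N * restr (~: N) htot.
Proof. by rewrite -mulrA -restrM melt_htot restr1 mulr1. Qed.

Definition nbr S : {set 'I_n} :=
  [set i | has (fun e => (e.1 == i) && (e.2 \in S) || (e.2 == i) && (e.1 \in S)) E].

Lemma sub_setC_nbr S U :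
  (U \subset ~: nbr S) = (cross E U S == 0%N) && (cross E S U == 0%N).
Proof.
have c0 A B : (cross E A B == 0%N) = ~~ has (fun e => (e.1 \in A) && (e.2 \in B)) E.
  by rewrite has_count lt0n negbK.
rewrite !c0 {c0}.
apply/subsetP/andP => [H|[/hasPn H1 /hasPn H2] i iU].
  split; apply/hasPn => e eE; apply/negP => /andP[h1 h2].
    have := H _ h1; rewrite !inE => /hasPn/(_ e eE).
    by rewrite eqxx h2.
  have := H _ h2; rewrite !inE => /hasPn/(_ e eE).
  by rewrite eqxx h1 orbT.
rewrite !inE; apply/hasPn => e eE; apply/negP => /orP[] /andP[/eqP ei eS].
  by have := H1 e eE; rewrite ei iU eS.
by have := H2 e eE; rewrite ei iU eS.
Qed.

Lemma stable_split S U : S \subset U ->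
  stable U = [&& stable S, stable (U :\: S) & U :\: S \subset ~: nbr S].
Proof.
move=> SU; rewrite sub_setC_nbr /stable.
have d : [disjoint S & U :\: S].
  by rewrite -setI_eq0 setIDA setD_eq0 subsetIl.
have {1 2}-> : U = S :|: (U :\: S).
  by rewrite setDE setUIr setUCr setIT (setUidPr SU).
by rewrite crossUl // !crossUr //; lia.
Qed.

(** The full alternating sum over subsets of [U :&: N] vanishes unless that set is empty; the
    subtracted term is that of [set0]. *)
Lemma sum_sign_nonempty N U :
  \sum_(S : {set 'I_n} | [&& S \subset U, S != set0 & S \subset N])
     (-1) ^+ #|U :\: S| =
  (U \subset ~: N)%:R * (-1) ^+ #|U| - (-1) ^+ #|U| :> {poly rat}.
Proof.
have sgn S : S \subset U ->
    (-1) ^+ #|U :\: S| = (-1) ^+ #|U| * (-1) ^+ #|S| :> {poly rat}.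
  move=> SU; rewrite -exprD -(cardsID S U) (setIidPr SU) addnAC exprD.
  by rewrite addnn -muln2 mulnC exprM sqrrN !expr1n mul1r.
have := sum_sign_interval {poly rat} (sub0set (U :&: N)).
rewrite cards0 mulr1 (bigD1 set0) ?sub0set //= cards0 expr0.
rewrite [set0 == _]eq_sym setI_eq0 disjoints_subset => /(congr1 (fun x => x - 1)).
rewrite addrAC subrr add0r => e.
rewrite -[X in _ - X]mul1r -mulrBl -e mulr_suml.
apply: eq_big => [S|S /and3P[SU _ _]]; last by rewrite sgn // mulrC.
by rewrite sub0set subsetI /= andbA andbAC.
Qed.

(* Removing the set [S] of all sinks leaves an orientation each of whose sinks is
   a neighbour of [S]. *)
Lemma sinksE N V : sinks N V = (V == set0)%:R +
  \sum_(S : {set 'I_n} | [&& S \subset V, S != set0, stable S & S \subset N])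
    'X^(cross E (V :\: S) S) * sinks (nbr S) (V :\: S).
Proof.
(* With the indicator of the empty set written as [htot * melt], every term becomes a sum over the
   argument [A] of [htot], and the identity is checked for each [A]. *)
rewrite -(setalg1E E) -htot_melt [sinks N V]setalgME [(htot * melt) V]setalgME.
under [X in _ + X]eq_bigr do rewrite setalgME big_distrr.
rewrite (exchange_big_dep (fun A : {set 'I_n} => A \subset V)) /=; last first.
  by move=> S A _ AVS; apply: subset_trans AVS (subsetDl _ _).
rewrite -big_split; apply: eq_bigr => A AV /=.
set U := V :\: A.
rewrite (eq_bigl (fun S : {set 'I_n} =>
  [&& [&& S \subset U, S != set0 & S \subset N] & stable S])); last first.
  move=> S; rewrite /U !subsetD AV [[disjoint S & A]]disjoint_sym /=.
  by case: (S \subset V) (S != set0) (stable S) (S \subset N) [disjoint A & S]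
    => [] [] [] [] [].
rewrite big_mkcondr.
under eq_bigr => S.
  move=> /and3P[SU _ _].
  (* A nonzero term has no edge between [S] and [U :\: S], so the powers of $q$ combine to
     [cross E A U]; only the sign depends on [S]. *)
  have -> : (if stable S then 'X^(cross E (V :\: S) S) * ('X^(cross E A (V :\: S :\: A))
       * htot A * restr (~: nbr S) melt (V :\: S :\: A)) else 0) =
     'X^(cross E A U) * htot A * (stable U)%:R * (-1) ^+ #|U :\: S|.
    have -> : V :\: S :\: A = U :\: S by rewrite /U !setDDl setUC.
    rewrite !ffunE (stable_split SU).
    case: (stable S); last by rewrite mulr0 mul0r.
    case: (stable (U :\: S)); last by rewrite !(mul0r, mulr0).
    rewrite sub_setC_nbr; case: eqP => [c0|_]; last by rewrite !(mul0r, mulr0).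
    case: eqP => [_|_]; last by rewrite !(mul0r, mulr0).
    have -> : cross E A U = (cross E A S + cross E A (U :\: S))%N.
      rewrite -crossUr; last by rewrite -setI_eq0 setIDA setD_eq0 subsetIl.
      by congr cross; rewrite setDE setUIr setUCr setIT (setUidPr SU).
    have -> : cross E (V :\: S) S = cross E A S.
      rewrite -[RHS]addn0 -c0 -crossUl; last first.
        by rewrite -setI_eq0 /U; apply/eqP/setP => i; rewrite !inE; case: (i \in A); rewrite ?andbF.
      congr cross; apply/setP => i; rewrite !inE.
      have := subsetP SU i; rewrite !inE; have := subsetP AV i.
      by case: (i \in S) (i \in A) (i \in V) => [] [] [] //= h1 h2; (try by have := h1 isT); by have := h2 isT.
    by rewrite /= exprD !mul1r !mulr1 !mulrA.
  over.
rewrite -big_distrr /= sum_sign_nonempty !ffunE.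
ring.
Qed.

(** The definition of [sinks] involves signs, but the recursion [sinksE] has none and descends to
    smaller sets because [S] is nonempty. *)
Lemma sinks_nat N V : sinks N V \is a polyOver Num.nat_num_subdef.
Proof.
have [k] := ubnP #|V|; elim: k V N => // k IH V N hV; rewrite sinksE rpredD //.
  by case: (V == set0); rewrite ?rpred1 ?rpred0.
apply: rpred_sum => S /and4P[SV S0 _ _]; apply: rpredM.
  by rewrite rpredX // polyOverX.
apply: IH; have := cardsID S V; rewrite (setIidPr SV).
by move: S0; rewrite -card_gt0; lia.
Qed.

(** An acyclic orientation of a nonempty set has a sink, so confining the sinks to [[set v]] makes
    [v] the unique one. The empty set gets 0. *)
Definition gtot : setalg E := [ffun V : {set 'I_n} => \sum_(v in V) sinks [set v] V].

(* An acyclic orientation with a marked vertex [v] splits into the vertices from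
   which [v] can be reached, and the rest. *)
Lemma card_htot V : #|V|%:R * htot V = (gtot * htot) V.
Proof.
rewrite setalgME mulr_natl -sumr_const.
transitivity (\sum_(v in V) \sum_(A : {set 'I_n} | A \subset V)
   'X^(cross E A (V :\: A)) * sinks [set v] A * ((v \in A)%:R * htot (V :\: A))).
  apply: eq_bigr => v vV; rewrite {1}(htot_sinks [set v]) setalgME.
  (* The remainder [V :\: A] avoids [v] exactly when [A] contains [v]. *)
  apply: eq_bigr => A AV; rewrite [restr _ _ _]ffunE; congr (_ * (_%:R * _)).
  by rewrite subsetC sub1set !inE vV andbT negbK.
rewrite exchange_big; apply: eq_bigr => A AV /=.
rewrite ffunE big_distrr big_distrl /= big_mkcond [RHS]big_mkcond.
apply: eq_bigr => v _; have := subsetP AV v.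
case: (v \in A) => [->|_] //; first by rewrite mul1r.
by rewrite mul0r mulr0 if_same.
Qed.

Definition elem k : setalg E := [ffun V : {set 'I_n} => (stable V && (#|V| == k))%:R].

Lemma grade_htot0 : grade 0 htot = 1.
Proof.
apply/ffunP => V; rewrite ffunE setalg1E cards_eq0.
by case: eqP => [->|_]; rewrite ?htot0 ?mul0r ?mul1r.
Qed.

(** This is the part of [htot * melt = 1] in degree [k.+1], solved for its leading term. *)
Lemma grade_htot_elem k : grade k.+1 htot =
  \sum_(j < k.+1) (-1) ^+ j *: (grade (k - j) htot * elem j.+1).
Proof.
have gm j : grade j melt = (-1) ^+ j *: elem j.
  apply/ffunP => V; rewrite !ffunE.
  case: eqP => [->|_]; last by rewrite andbF mul0r scaler0.
  rewrite andbT mul1r; case: (stable V); rewrite ?mul0r ?scaler0 // mul1r.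
  by rewrite -mul_polyC mulr1 rmorphXn rmorphN1.
have m0 : grade 0 melt = 1.
  apply/ffunP => V; rewrite ffunE setalg1E cards_eq0.
  by case: eqP => [->|_]; rewrite ?melt0 ?mul0r ?mul1r.
have := gradeM k.+1 htot melt; rewrite htot_melt big_ord_recr /= subnn m0 mulr1.
have -> : grade k.+1 1 = 0.
  apply/ffunP => V; rewrite [LHS]ffunE setalg1E [RHS]ffunE.
  by have [->|_] := eqVneq V set0; rewrite ?cards0 ?mul0r ?mulr0.
move/esym/eqP; rewrite addrC addr_eq0 => /eqP ->.
(* The reversed index lists the terms by the size [j.+1] of the stable set; crossing the equation
   turns $(-1)^{j+1}$ into $(-1)^j$. *)
rewrite (reindex_inj rev_ord_inj) -sumrN; apply: eq_bigr => j _ /=.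
have -> : (k.+1 - (k.+1 - j.+1) = j.+1)%N by have := ltn_ord j; lia.
by rewrite gm -scalerAr -scaleNr exprS mulN1r opprK subSS.
Qed.

(** This is [card_htot] in degree [k.+1]; the sum starts at degree 1 because [gtot] vanishes on the
    empty set. *)
Lemma grade_htot_gtot k : k.+1%:R *: grade k.+1 htot =
  \sum_(j < k.+1) grade j.+1 gtot * grade (k - j) htot.
Proof.
have -> : k.+1%:R *: grade k.+1 htot = grade k.+1 (gtot * htot).
  apply/ffunP => V; rewrite ffunE [RHS]ffunE -card_htot [grade _ _ _]ffunE.
  case: eqP => [->|_]; last by rewrite !mul0r scaler0.
  by rewrite !mul1r scaler_nat mulr_natl.
rewrite gradeM big_ord_recl.
have -> : grade 0 gtot = 0.
  apply/ffunP => V; rewrite !ffunE cards_eq0.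
  by case: eqP => [->|_]; rewrite ?big_set0 ?mulr0 ?mul0r.
by rewrite mul0r add0r; apply: eq_bigr => j _; rewrite /= /bump /= subSS.
Qed.

Lemma rprod_nat a V : rprod (grade^~ gtot) a V \is a polyOver Num.nat_num_subdef.
Proof.
elim: a V => [|k a IH] V /=.
  by rewrite setalg1E; case: (V == set0); rewrite ?rpred1 ?rpred0.
rewrite setalgME; apply: rpred_sum => A _; apply: rpredM.
  by apply: rpredM => //; rewrite rpredX // polyOverX.
rewrite !ffunE; apply: rpredM; first by case: (_ == k); rewrite ?rpred1 ?rpred0.
by apply: rpred_sum => v _; exact: sinks_nat.
Qed.
End Elements.

(** * Types of monomials *)

(** Induction that strips all copies of the least letter at once, matching one part of the type. *)
Lemma sorted_word_ind (P : seq nat -> Prop) : P [::] ->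
  (forall k x w, sorted leq w -> all (ltn x) w -> P w -> P (nseq k.+1 x ++ w)) ->
  forall w, sorted leq w -> P w.
Proof.
move=> P0 PS w; have [m] := ubnP (size w); elim: m w => // m IH [|x w] // hs sw.
have [k [w' [ew lw sw']]] : exists k w', [/\ w = nseq k x ++ w', all (ltn x) w' & sorted leq w'].
  elim: w sw {hs IH} => [|y w IHw] /=; first by exists 0%N, [::].
  case/andP; rewrite leq_eqVlt => /orP[/eqP<- /IHw[k [w' [-> ? ?]]]|xy yw].
    by exists k.+1, w'.
  exists 0%N, (y :: w); split=> //=; rewrite xy /=.
  by apply: sub_all (order_path_min leq_trans yw) => z /=; apply: leq_trans.
rewrite ew -[x :: _]/(nseq k.+1 x ++ w'); apply: PS => //; apply: IH => //.
by move: hs; rewrite ew /= size_cat size_nseq; lia.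
Qed.

(** For sorted [w] these are the exponents of the monomial in increasing order of the variables. *)
Definition wtype (w : seq nat) : seq nat := [seq count_mem x w | x <- undup w].

Lemma notin_gt x (w : seq nat) : all (ltn x) w -> x \notin w.
Proof. by move=> lw; apply/negP => /(allP lw) /=; rewrite ltnn. Qed.

Lemma undup_block k x w : all (ltn x) w -> undup (nseq k.+1 x ++ w) = x :: undup w.
Proof.
move=> /notin_gt xw; elim: k => [|k IH]; first by rewrite /= (negbTE xw).
set s := nseq k.+1 x ++ w in IH *.
by rewrite -[LHS]/(if x \in s then undup s else x :: undup s) IH mem_head.
Qed.

Lemma wtype_block k x w : all (ltn x) w -> wtype (nseq k.+1 x ++ w) = k.+1 :: wtype w.
Proof.
move=> lw; rewrite /wtype undup_block // map_cons count_cat count_nseq [pred1 x x]/= eqxx mul1n.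
rewrite (count_memPn _) ?notin_gt // addn0; congr (_ :: _).
apply/eq_in_map => y; rewrite mem_undup => yw; rewrite count_cat count_nseq /=.
by have /= := allP lw y yw; case: eqP => // ->; rewrite ltnn.
Qed.

Lemma wtype_compositions n w : is_mono n w -> wtype w \in compositions n.
Proof.
case/and3P=> /eqP<- sw _; rewrite mem_compositions.
elim/sorted_word_ind: sw => //= k x {}w _ lw /andP[/eqP sw pw].
by rewrite -[x :: _]/(nseq k.+1 x ++ w) wtype_block //= sw pw size_cat size_nseq addSn eqxx.
Qed.

Lemma nseq_cat_inj k l (x : nat) (u v : seq nat) : x \notin u -> x \notin v ->
  (nseq k x ++ u == nseq l x ++ v) = (k == l) && (u == v).
Proof.
move=> xu xv; elim: k l => [|k IH] [|l] //=.
- by case: (u) xu => //= y ?; rewrite inE eqseq_cons eq_sym => /norP[/negbTE->].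
- by case: (v) xv => //= y ?; rewrite inE eqseq_cons => /norP[/negbTE->].
- by rewrite eqseq_cons eqxx IH.
Qed.

Lemma mem_zip_snd (S T : eqType) (s : seq S) (t : seq T) c y :
  (c, y) \in zip s t -> y \in t.
Proof.
elim: s t => [|a s IH] [|b t] //=.
by rewrite !inE xpair_eqE => /orP[/andP[_ ->]|/IH ->] //; rewrite orbT.
Qed.

Lemma eq_wtype b w : sorted leq w ->
  (size b == size (undup w)) && (w == flatten [seq nseq p.1 p.2 | p <- zip b (undup w)])
  = (b == wtype w).
Proof.
move=> sw; elim/sorted_word_ind: sw b => [|k x {}w _ lw IH] b.
  by case: b.
rewrite undup_block // wtype_block //; case: b => [|l b] //.
rewrite eqseq_cons -IH /= eqSS -[x :: _]/(nseq k.+1 x ++ w) nseq_cat_inj ?(notin_gt lw) //.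
  by rewrite andbCA [k.+1 == l]eq_sym.
apply/negP => /flatten_mapP[[c y] /mem_zip_snd yw] /=; rewrite mem_nseq => /andP[_ /eqP xy].
by move: yw; rewrite -xy mem_undup; apply/negP/notin_gt.
Qed.

Lemma McoefE n b w : is_mono n w -> b \in compositions n -> Mcoef b w = (b == wtype w).
Proof. by case/and3P=> _ sw _ /compositions_pos pb; rewrite /Mcoef [all _ b]pb eq_wtype. Qed.

Definition ascents (n : nat) (w : seq nat) : {set 'I_n.-1} :=
  [set i : 'I_n.-1 | (nth 0 w i < nth 0 w i.+1)%N].

(** A partial sum of the type marks the end of a block of equal letters, where the next letter
    jumps. This ties the type, seen by [Mcoef], to the ascents, seen by [Fcoef]. *)
Lemma cset_wtype n w : is_mono n w -> cset n (wtype w) = ascents n w.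
Proof.
case/and3P=> /eqP<- sw _.
suff H i : (i.+1 < size w)%N -> (i.+1 \in psums (wtype w)) = (nth 0 w i < nth 0 w i.+1)%N.
  by apply/setP => i; rewrite !inE H //; move: (ltn_ord i); lia.
elim/sorted_word_ind: sw i => // k x {}w _ lw IH i.
rewrite size_cat size_nseq => hi; rewrite wtype_block // psums_cons inE !nth_cat size_nseq.
rewrite !nth_nseq; case: (ltngtP i k) => ik.
- have -> : (i < k.+1)%N by lia.
  have -> : (i.+1 < k.+1)%N by lia.
  rewrite ltnn; apply/negbTE; rewrite negb_or; apply/andP; split; first by lia.
  by apply/mapP => -[y _]; lia.
- have -> : (i < k.+1)%N = false by lia.
  have -> : (i.+1 < k.+1)%N = false by lia.
  have -> : (i.+1 - k.+1 = (i - k.+1).+1)%N by lia.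
  rewrite -IH; last by lia.
  have -> : i.+1 = (k.+1 + (i - k.+1).+1)%N by lia.
  rewrite mem_map; last exact: addnI.
  rewrite (_ : _ == _ = false) /=; last by lia.
  by congr (_ \in _); lia.
- rewrite ik eqxx /= ltnSn ltnn subnn; symmetry; apply: (allP lw); apply: mem_nth.
  by rewrite -(ltn_add2l k.+1) addn0 -{1}ik.
Qed.

(** A test monomial with ascent set exactly [U]: the letters start at 1, to be positive, and grow by
    one at each element of [U]. *)
Definition word (n : nat) (U : {set 'I_n.-1}) : seq nat :=
  mkseq (fun p => #|[set i in U | (i < p)%N]|.+1) n.

Lemma word_mono n (U : {set 'I_n.-1}) : is_mono n (word U).
Proof.
apply/and3P; split; first by rewrite size_mkseq.
  rewrite /word /mkseq; apply: (@homo_sorted _ _ _ leq) (iota_sorted 0 n) => p q pq.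
  rewrite ltnS subset_leq_card //; apply/subsetP => i; rewrite !inE.
  by case/andP=> -> /leq_trans->.
by apply/allP => _ /mapP[p _ ->].
Qed.

Lemma ascents_word n (U : {set 'I_n.-1}) : ascents n (word U) = U.
Proof.
apply/setP => p; rewrite inE; have hp := ltn_ord p.
rewrite !nth_mkseq; [|lia|lia]; rewrite ltnS.
have [pU|pU] := boolP (p \in U).
  rewrite (_ : [set i in U | (i < p.+1)%N] = p |: [set i in U | (i < p)%N]).
    by rewrite cardsU1 !inE ltnn andbF add1n ltnSn.
  apply/setP => i; rewrite !inE ltnS leq_eqVlt val_eqE.
  by case: eqP => [->|] //=; rewrite pU.
rewrite (_ : [set i in U | (i < p.+1)%N] = [set i in U | (i < p)%N]) ?ltnn //.
apply/setP => i; rewrite !inE ltnS leq_eqVlt val_eqE.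
by case: eqP => [->|] //=; rewrite (negbTE pU).
Qed.

Lemma wtype_word n a : a \in compositions n -> wtype (word (cset n a)) = a.
Proof.
move=> ha; apply: (@cset_inj n) => //; first exact: wtype_compositions (word_mono _).
by rewrite cset_wtype ?word_mono // ascents_word.
Qed.

(** * Colorings *)

Section PartialColorings.
Variables (n : nat) (E : seq ('I_n * 'I_n)) (N : nat).
Implicit Types (A V : {set 'I_n}) (w : seq nat) (kappa : {ffun 'I_n -> 'I_N.+1}).

(* Color 0 marks the vertices outside [V]; genuine colors are positive. *)
Definition colors V w kappa : bool :=
  perm_eq [seq val (kappa i) | i <- enum V] w && [forall (i | i \notin V), kappa i == ord0].

Definition induced V : seq ('I_n * 'I_n) := [seq e <- E | (e.1 \in V) && (e.2 \in V)].

Definition XGpart V w : {poly rat} :=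
  \sum_(kappa : {ffun 'I_n -> 'I_N.+1} |
      colors V w kappa && Defs.proper (induced V) (fun i => val (kappa i)))
    'X^(asc (induced V) (fun i => val (kappa i))).

Lemma XGpart_nil V : XGpart V [::] = (V == set0)%:R.
Proof.
have [->|V0] := eqVneq V set0.
  have e0 : induced set0 = [::].
    by rewrite /induced -(filter_pred0 E); apply: eq_filter => e; rewrite /= inE.
  rewrite /XGpart (big_pred1 [ffun=> ord0]) ?e0 // => kappa.
  rewrite /colors enum_set0 andbT /=; apply/forall_inP/eqP => [H|-> i _].
    by apply/ffunP => i; rewrite ffunE; apply/eqP/H; rewrite inE.
  by rewrite ffunE.
rewrite /XGpart big_pred0 // => kappa; apply/negbTE; rewrite !negb_and.
apply/orP; left; apply/orP; left; apply/negP => /perm_size/eqP.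
by rewrite size_map -cardE cards_eq0 (negbTE V0).
Qed.

Lemma mem_colors V w kappa i : colors V w kappa -> i \in V -> val (kappa i) \in w.
Proof.
case/andP=> /perm_mem <- _ iV.
by apply: (map_f (fun i => val (kappa i))); rewrite mem_enum.
Qed.

Definition paint (c : 'I_N.+1) A kappa : {ffun 'I_n -> 'I_N.+1} :=
  [ffun i => if i \in A then c else kappa i].

(** The left side collects the conditions left by [reindex_onto]: painting [A] with [x] and
    resetting it to 0 are mutually inverse. *)
Lemma colors_block (k : nat) (x : 'I_N.+1) w A V kappa :
  (0 < x)%N -> all (ltn x) w -> A \subset V -> #|A| = k ->
  [&& colors V (nseq k (val x) ++ w) (paint x A kappa),
      [set i | paint x A kappa i == x] == A & paint ord0 A (paint x A kappa) == kappa]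
  = colors (V :\: A) w kappa.
Proof.
move=> x0 lw AV cA.
have pV : perm_eq (enum V) (enum A ++ enum (V :\: A)).
  apply: uniq_perm; rewrite ?enum_uniq // ?cat_uniq ?enum_uniq ?andbT //=.
    by apply/hasPn => i; rewrite !mem_enum inE => /andP[].
  move=> i; rewrite mem_cat !mem_enum inE; have := subsetP AV i.
  by case: (i \in A) => [->|].
have e1 : perm_eq [seq val (paint x A kappa i) | i <- enum V] (nseq k (val x) ++ w)
   = perm_eq [seq val (kappa i) | i <- enum (V :\: A)] w.
  rewrite (permPl (perm_map _ pV)) map_cat.
  have -> : [seq val (paint x A kappa i) | i <- enum A] = nseq k (val x).
    rewrite -cA cardE -(size_map (fun i => val (paint x A kappa i)) (enum A)).
    apply/all_pred1P; rewrite all_map; apply/allP => i.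
    by rewrite mem_enum /= ffunE => ->.
  rewrite perm_cat2l; congr perm_eq; apply/eq_in_map => i.
  by rewrite mem_enum inE ffunE => /andP[/negbTE->].
apply/and3P/idP => [[/andP[h1 /forall_inP h2] h3 /eqP/ffunP h4]|hk].
  rewrite /colors -e1 h1; apply/forall_inP => i; rewrite inE negb_and negbK.
  have := h4 i; rewrite !ffunE; case: (boolP (i \in A)) => [_ <- _|iA _ /= iV] //.
  by have := h2 i iV; rewrite ffunE (negbTE iA).
have := hk; rewrite /colors -e1 => /andP[h1 /forall_inP h2].
split.
- rewrite h1; apply/forall_inP => i iV; rewrite ffunE.
  have iA : i \notin A by apply: contra iV; exact: (subsetP AV).
  by rewrite (negbTE iA) h2 // inE (negbTE iV) andbF.
- apply/eqP/setP => i; rewrite inE ffunE; case: (boolP (i \in A)) => iA; first exact: eqxx.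
  (* Outside [A] the color [x] cannot occur: colors from [w] exceed it, and the filler 0 is below
     it. *)
  apply/negbTE; have [iV|iV] := boolP (i \in V).
    have iVA : i \in V :\: A by rewrite inE iA.
    have /= := allP lw _ (mem_colors hk iVA); apply: contraTneq => ->.
    by rewrite ltnn.
  have /eqP-> : kappa i == ord0 by apply: h2; rewrite inE (negbTE iV) andbF.
  by rewrite -val_eqE /= neq_ltn x0.
- apply/eqP/ffunP => i; rewrite !ffunE; case: (boolP (i \in A)) => // iA.
  by apply/esym/eqP/h2; rewrite inE iA.
Qed.

(** Since [x] is the least color on [V], an edge leaving [A] ascends and an edge entering [A]
    descends. *)
Lemma paint_edges (x : 'I_N.+1) w A V kappa (e : 'I_n * 'I_n) :
  all (ltn x) w -> A \subset V -> colors (V :\: A) w kappa ->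
  (e.1 \in V) && (e.2 \in V) ->
  let l i := val (paint x A kappa i) in
  ((l e.1 < l e.2)%N = (e.1 \in A) && (e.2 \in V :\: A) ||
    [&& e.1 \in V :\: A, e.2 \in V :\: A & (kappa e.1 < kappa e.2)%N]) /\
  ((l e.1 == l e.2) = (e.1 \in A) && (e.2 \in A) ||
    [&& e.1 \in V :\: A, e.2 \in V :\: A & kappa e.1 == kappa e.2 :> nat]).
Proof.
move=> lw AV hk /andP[V1 V2] /=; rewrite !ffunE !inE V1 V2 !andbT.
have gt i : i \in V -> i \notin A -> (x < kappa i)%N.
  by move=> iV iA; apply: (allP lw); apply: (mem_colors hk); rewrite inE iA.
case: (boolP (e.1 \in A)) => h1; case: (boolP (e.2 \in A)) => h2 /=.
- by rewrite ltnn eqxx.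
- by have := gt _ V2 h2; lia.
- by have := gt _ V1 h1; lia.
- by [].
Qed.

(** The vertices of least color [x] form a stable set of size [k], and the ascents meeting it are
    the edges from it to the rest. *)
Lemma XGpart_block (k : nat) (x : 'I_N.+1) w V :
  (0 < x)%N -> all (ltn x) w ->
  XGpart V (nseq k (val x) ++ w) = \sum_(A : {set 'I_n} | A \subset V)
    'X^(cross E A (V :\: A)) * (stable E A && (#|A| == k))%:R * XGpart (V :\: A) w.
Proof.
move=> x0 lw.
transitivity (\sum_(A : {set 'I_n} | [&& A \subset V, stable E A & #|A| == k])
    'X^(cross E A (V :\: A)) * XGpart (V :\: A) w); last first.
  rewrite [RHS](bigID (fun A => stable E A && (#|A| == k))) /=.
  rewrite [X in _ = _ + X]big1 ?addr0 => [|A /andP[_ /negbTE->]]; last first.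
    by rewrite mulr0 mul0r.
  by apply: eq_bigr => A /andP[_ ->]; rewrite mulr1.
rewrite /XGpart (partition_big (fun kappa => [set i | kappa i == x])
  (fun A : {set 'I_n} => [&& A \subset V, stable E A & #|A| == k])) /=; last first.
  move=> kappa /andP[/andP[hp /forall_inP h0] /allP hpr].
  have AV : [set i | kappa i == x] \subset V.
    apply/subsetP => i; rewrite inE => /eqP ki; apply: contraLR x0 => /h0.
    by rewrite ki => /eqP->.
  apply/and3P; split=> //.
    rewrite /stable /cross eqn0Ngt -has_count; apply/hasPn => e eE; apply/negP.
    case/andP=> e1 e2; have := hpr e.
    rewrite mem_filter (subsetP AV _ e1) (subsetP AV _ e2) eE => /(_ isT).
    by move: e1 e2; rewrite !inE => /eqP-> /eqP->; rewrite eqxx.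
  have /permP/(_ (pred1 (val x))) := hp.
  rewrite count_cat count_nseq /= eqxx mul1n (count_memPn (notin_gt lw)) addn0 => <-.
  rewrite count_map -size_filter cardE; apply/eqP/perm_size/uniq_perm.
  - exact: enum_uniq.
  - by rewrite filter_uniq ?enum_uniq.
  move=> i; rewrite [LHS]mem_enum mem_filter mem_enum /= inE val_eqE andbC.
  by have := subsetP AV i; rewrite inE; case: eqP => [_ -> //|_ _]; rewrite andbF.
apply: eq_bigr => A /and3P[AV sA /eqP cA].
rewrite (reindex_onto (paint x A) (paint ord0 A)) /=; last first.
  move=> kappa /andP[_ /eqP eA]; apply/ffunP => i; rewrite !ffunE.
  by case: (boolP (i \in A)) => // iA; move: (iA); rewrite -{1}eA inE => /eqP->.
rewrite big_distrr /=.
have ed (kappa : {ffun 'I_n -> 'I_N.+1}) (hk : colors (V :\: A) w kappa) e :=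
  @paint_edges x w A V kappa e lw AV hk.
apply: eq_big => [kappa|kappa].
  have cb := colors_block kappa x0 lw AV cA.
  have [hk|/negbTE hk] := boolP (colors (V :\: A) w kappa); last first.
    rewrite hk in cb; apply/negbTE.
    by apply: contraFN cb => /andP[/andP[/andP[-> _] ->] ->].
  move: cb; rewrite hk => /and3P[-> -> ->].
  rewrite !andbT /=; apply/allP/allP => H e; rewrite mem_filter => /andP[/andP[e1 e2] eE].
    move: (e1) (e2); rewrite !inE => /andP[A1 V1] /andP[A2 V2].
    have := H e; rewrite mem_filter V1 V2 eE => /(_ isT).
    have [_ ->] := ed kappa hk e (introT andP (conj V1 V2)).
    by rewrite e1 e2 (negbTE A1).
  have [_ ->] := ed kappa hk e (introT andP (conj e1 e2)).
  have -> /= : (e.1 \in A) && (e.2 \in A) = false.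
    apply/negP => hA; move: sA; rewrite /stable /cross eqn0Ngt -has_count.
    by move/negP; apply; apply/hasP; exists e.
  apply/negP => /and3P[h1 h2 h3]; have := H e.
  by rewrite mem_filter h1 h2 eE h3 => /(_ isT).
case/andP=> /andP[/andP[c1 _] c2] c3.
have hk : colors (V :\: A) w kappa by rewrite -(colors_block kappa x0 lw AV cA) c1 c2 c3.
rewrite -exprD; congr ('X^_); rewrite /asc /induced !count_filter /cross.
rewrite -count_predUI [X in (_ = _ + X)%N](_ : _ = 0%N); last first.
  rewrite -(count_pred0 E); apply: eq_count => e /=; rewrite !inE.
  by case: (e.1 \in A); rewrite /= ?andbF.
rewrite addn0; apply: eq_count => e /=.
have [hV|hV] := boolP ((e.1 \in V) && (e.2 \in V)).
  by have [-> _] := ed kappa hk e hV; rewrite andbT; congr (_ || _); rewrite [RHS]andbC -andbA.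
rewrite andbF; symmetry; apply: contraNF hV; rewrite !inE.
by case/orP=> [/andP[/(subsetP AV)-> /andP[_ ->]]|/and3P[_ /andP[_ ->] /andP[_ ->]]].
Qed.

(** The least color gives the leftmost factor, whereas [rprod] puts the head of its list on the
    right; hence the [rev]. *)
Lemma XGpartE V w : sorted leq w -> all (fun j => 0 < j <= N)%N w ->
  XGpart V w = rprod (elem E) (rev (wtype w)) V.
Proof.
move=> sw; elim/sorted_word_ind: sw V => [|k x {}w _ lw IH] V.
  by rewrite XGpart_nil /= setalg1E.
rewrite all_cat => /andP[/andP[/andP[x0 xN] _] hw].
rewrite wtype_block // rev_cons rprod_rcons setalgME.
rewrite -[x]/(val (Ordinal (xN : (x < N.+1)%N))) XGpart_block //.
by apply: eq_bigr => A _; rewrite IH // ffunE.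
Qed.
End PartialColorings.

Lemma XGcoefE (n : nat) (E : seq ('I_n * 'I_n)) w : is_mono n w ->
  XGcoef E w = rprod (elem E) (rev (wtype w)) setT.
Proof.
case/and3P=> _ sw pw; rewrite -(@XGpartE _ E (sumn w)) //; last first.
  apply/allP => j jw; have /= -> := allP pw j jw.
  by elim: w jw {sw pw} => //= y w IH; rewrite inE => /orP[/eqP->|/IH]; lia.
rewrite /XGpart /XGcoef -big_mkcond /=.
have -> : induced E setT = E.
  by rewrite /induced -[RHS](filter_predT E); apply: eq_filter => e; rewrite !inE.
apply: eq_bigl => kappa; rewrite andbC; congr (_ && _).
rewrite /colors enum_setT -enumT [X in _ && X](_ : _ = true) ?andbT; last first.
  by apply/forall_inP => i; rewrite inE.
apply/eqP/idP => [e|pe]; first by rewrite -(perm_sort leq) e.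
apply: (sorted_eq leq_trans anti_leq) => //; first exact: (sort_sorted leq_total).
by rewrite perm_sort.
Qed.

(** * The coefficients of Psi and Moebius inversion *)

Lemma psum_catl a b j : (j <= size a)%N -> psum (a ++ b) j = psum a j.
Proof. by move=> ja; rewrite /psum takel_cat. Qed.

Lemma psum_catr a b j : psum (a ++ b) (size a + j) = (sumn a + psum b j)%N.
Proof. by rewrite /psum take_cat ltnNge leq_addr /= addKn sumn_cat. Qed.

Lemma psum_le a j : (psum a j <= sumn a)%N.
Proof. by rewrite -[in X in (_ <= X)%N](cat_take_drop j a) sumn_cat leq_addr. Qed.

Lemma psum_lt a j : all (ltn 0) a -> (j < size a)%N -> (psum a j < sumn a)%N.
Proof.
move=> pa ja; rewrite -[in X in (_ < X)%N](cat_take_drop j a) sumn_cat -/(psum a j).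
rewrite (drop_nth 0%N) //=; have /= := allP pa _ (mem_nth 0%N ja); lia.
Qed.

Lemma psum_gt0 a j : all (ltn 0) a -> (j < size a)%N -> (0 < psum a j.+1)%N.
Proof.
case: a => //= k a /andP[/= k0 _] _; rewrite /psum /=; lia.
Qed.

Lemma pi2_nil : pi2 [::] [::] = 1%N.
Proof. by rewrite /pi2 big_ord0. Qed.

Section SubcompCat.
Variables (k : nat) (a1 a b : seq nat).
Hypotheses (k0 : (0 < k)%N) (s1 : sumn a1 = k) (p1 : all (ltn 0) a1) (pa : all (ltn 0) a).

Lemma subcomp_cat0 : subcomp (a1 ++ a) (k :: b) 0 = a1.
Proof.
rewrite /subcomp size_cat iotaD filter_cat map_cat add0n.
rewrite [X in X ++ _](_ : _ = a1); last first.
  rewrite (eq_in_filter (a2 := predT)); last first.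
    move=> j; rewrite mem_iota /= => hj; rewrite /psum /= take0 addn0 -/(psum _ _).
    by rewrite -/(psum _ j.+1) psum_catl ?leq0n -?s1 ?psum_le.
  rewrite filter_predT -[RHS](mkseq_nth 0%N) /mkseq; apply/eq_in_map => j.
  by rewrite mem_iota nth_cat => /= ->.
rewrite (eq_in_filter (a2 := pred0)) ?filter_pred0 ?cats0 // => j.
rewrite mem_iota => /andP[h1 h2]; apply/negbTE; rewrite negb_and -!ltnNge.
have -> : j.+1 = (size a1 + (j - size a1).+1)%N by lia.
rewrite psum_catr s1 [psum (k :: b) 1]/psum /= take0 addn0.
have := @psum_gt0 a (j - size a1) pa; lia.
Qed.

Lemma subcomp_catS i : subcomp (a1 ++ a) (k :: b) i.+1 = subcomp a b i.
Proof.
rewrite /subcomp size_cat iotaD filter_cat map_cat add0n.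
rewrite [X in X ++ _](_ : _ = [::]); last first.
  rewrite (eq_in_filter (a2 := pred0)) ?filter_pred0 // => j; rewrite mem_iota /= => hj.
  apply/negbTE; rewrite negb_and -!ltnNge psum_catl; last lia.
  have := psum_lt p1 hj; rewrite s1 /psum /=; lia.
rewrite cat0s -[size a1 in LHS]addn0 iotaDl filter_map -map_comp.
rewrite (eq_filter (a2 := fun j => (psum b i <= psum a j)%N &&
    (psum a j.+1 <= psum b i.+1)%N)); last first.
  move=> j /=; rewrite -addnS !psum_catr s1 [psum (k :: b) i.+1]/psum /=.
  by rewrite [psum (k :: b) i.+2]/psum /= !leq_add2l.
by apply: eq_map => j /=; rewrite nth_cat ltnNge leq_addr /= addKn.
Qed.

(** This is the multiplicativity that [sum_refinements] asks of its weight. *)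
Lemma pi2_cat : pi2 (a1 ++ a) (k :: b) = (pi1 a1 * pi2 a b)%N.
Proof.
rewrite /pi2 /= big_ord_recl subcomp_cat0; congr (_ * _)%N.
by apply: eq_bigr => i _; rewrite subcomp_catS.
Qed.
End SubcompCat.

Lemma psums_rev a s : s \in psums a -> (s < sumn a)%N ->
  (sumn a - s)%N \in psums (rev a).
Proof.
rewrite psumsE => /mapP[j _ ->] hs.
have e : sumn a = (psum a j + sumn (drop j a))%N by rewrite /psum -sumn_cat cat_take_drop.
have -> : (sumn a - psum a j)%N = sumn (rev (drop j a)) by rewrite sumn_rev e addKn.
rewrite -[in psums _](cat_take_drop j a) rev_cat psums_cat mem_cat sumn_psums //.
by case: (rev _) (sumn_rev (drop j a)) => //= e'; move: hs; rewrite e -e' addn0 ltnn.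
Qed.

Lemma rev_compositions n a : a \in compositions n -> rev a \in compositions n.
Proof. by rewrite !mem_compositions sumn_rev all_rev. Qed.

Lemma cset_rev n a : a \in compositions n ->
  cset n (rev a) = [set rev_ord i | i in cset n a].
Proof.
move=> ha; have sa := compositions_sum ha.
have H c (hc : c \in compositions n) (i : 'I_n.-1) :
    i \in cset n c -> rev_ord i \in cset n (rev c).
  rewrite !inE /= => hi; have hn := ltn_ord i.
  (* In the shifted encoding, [rev_ord] is $s \mapsto n - s$. *)
  have -> : (n.-1 - i.+1).+1 = (sumn c - i.+1)%N by rewrite (compositions_sum hc); lia.
  by apply: psums_rev => //; rewrite (compositions_sum hc); lia.
apply/setP => i; apply/idP/imsetP => [hi|[j hj ->]]; last exact: H.
exists (rev_ord i); last by rewrite rev_ordK.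
by rewrite -[a]revK; apply: H => //; apply: rev_compositions.
Qed.

Lemma card_cset n a : a \in compositions n -> #|cset n a| = (size a).-1.
Proof.
move=> ha; have <- : size (Sset a) = (size a).-1 by rewrite size_map size_iota.
have sS : Sset a = take (size a).-1 (psums a).
  by rewrite psumsE -map_take take_iota (minn_idPl _) // leq_pred.
rewrite cardE -(size_map (fun i : 'I_n.-1 => i.+1)); apply/perm_size/uniq_perm.
- by rewrite map_inj_uniq ?enum_uniq // => i j [] /val_inj.
- rewrite sS take_uniq // (sorted_uniq ltn_trans ltnn) //.
  exact: psums_sorted (compositions_pos ha).
move=> s; rewrite (mem_Sset _ ha); apply/mapP/andP => [[i]|[sn sp]].
  rewrite mem_enum inE => hi ->; split=> //; by have := ltn_ord i; lia.
have /andP[s0 _] := mem_psums (compositions_pos ha) sp.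
have hs : (s.-1 < n.-1)%N by lia.
by exists (Ordinal hs); rewrite ?mem_enum ?inE /= prednK.
Qed.

(** For $n > 0$ this is $(n-1)-(\ell-1)$; for $n = 0$ both sides vanish. It is the sign exponent in
    [homogeneous_elementary]. *)
Lemma card_setC_cset n a : a \in compositions n -> #|~: cset n a| = (n - size a)%N.
Proof.
move=> ha; have := cardsC (cset n a); rewrite card_ord (card_cset ha).
have hs := size_compositions ha; have : (0 < n)%N -> (0 < size a)%N.
  by case: (a) (compositions_sum ha) => //= <-.
by move: #|_| (size a) hs => c s; lia.
Qed.

Lemma sum_cset (V : nmodType) n (F : {set 'I_n.-1} -> V) :
  \sum_(T : {set 'I_n.-1}) F T = \sum_(a <- compositions n) F (cset n a).
Proof.
rewrite -(big_map (cset n) predT F); apply: perm_big; apply: uniq_perm.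
- exact: index_enum_uniq.
- by rewrite map_inj_in_uniq ?compositions_uniq //; exact: cset_inj.
move=> U; rewrite mem_index_enum; symmetry; apply/mapP; exists (wtype (word U)).
  exact: wtype_compositions (word_mono U).
by rewrite cset_wtype ?word_mono // ascents_word.
Qed.

Lemma zee_gt0 n a : a \in compositions n -> (0 < zee a)%N.
Proof.
move=> ha; rewrite /zee big_seq_cond; apply: prodn_cond_gt0 => i /andP[].
rewrite mem_undup => ia _; have /= i0 := allP (compositions_pos ha) i ia.
by rewrite muln_gt0 expn_gt0 i0 fact_gt0.
Qed.

(** A monomial occurs in $M_\beta$ only when $\beta$ is its type, so the sum collapses to one
    term. *)
Lemma PsicoefE n a w : is_mono n w -> a \in compositions n ->
  Psicoef n a w / (zee a)%:R =
  if comp_le a (wtype w) then (pi2 a (wtype w))%:R^-1 else 0.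
Proof.
move=> mw ha; rewrite /Psicoef mulrC mulKf; last by rewrite pnatr_eq0 -lt0n (zee_gt0 ha).
have hw := wtype_compositions mw.
rewrite big_mkcond (bigD1_seq (wtype w)) ?compositions_uniq //= (McoefE mw hw) eqxx mulr1.
rewrite big_seq_cond big1 ?addr0 // => b /andP[hb /negbTE nb].
by rewrite (McoefE mw hb) nb mulr0 if_same.
Qed.

Section Moebius.
Variables (R : comNzRingType) (T : finType) (f : {set T} -> R).
Implicit Types S U D : {set T}.

Definition moebius S : R := \sum_(U : {set T} | U \subset S) (-1) ^+ (#|S| + #|U|) * f U.

Lemma sum_moebius_sub D : \sum_(S : {set T} | S \subset D) moebius S = f D.
Proof.
rewrite (exchange_big_dep (fun U : {set T} => U \subset D)) /=; last first.
  by move=> S U SD US; apply: subset_trans SD.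
rewrite (bigD1 D) //= (big_pred1 D) => [|S]; last by rewrite /= -eqEsubset.
rewrite -signr_odd oddD addbb mul1r big1 ?addr0 // => U /andP[UD nU].
under eq_bigr do rewrite exprD -mulrA.
rewrite -mulr_suml (eq_bigl (fun S => (U \subset S) && (S \subset D))) => [|S].
  by rewrite sum_sign_interval // (negbTE nU) !mul0r.
by rewrite andbC.
Qed.

(** After exchanging sums, the inner one runs over the interval from [~: D :|: U] to the full set
    and vanishes unless the two coincide, that is, unless [D \subset U]. *)
Lemma sum_moebius_sup D :
  \sum_(S : {set T} | ~: D \subset S) moebius S =
  \sum_(U : {set T} | D \subset U) (-1) ^+ #|~: U| * f U.
Proof.
rewrite (exchange_big_dep predT) //= [RHS]big_mkcond; apply: eq_bigr => U _.
under eq_bigr do rewrite exprD -mulrA.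
rewrite -mulr_suml (eq_bigl (fun S => (~: D :|: U \subset S) && (S \subset setT))) => [|S].
  rewrite sum_sign_interval ?subsetT //.
  have -> : (~: D :|: U == setT) = (D \subset U).
    by rewrite -subTset -subDset setTD setCK.
  case: ifP => DU; last by rewrite !mul0r.
  have -> : ~: D :|: U = setT.
    by apply/eqP; rewrite -subTset -subDset setTD setCK.
  rewrite mul1r mulrA -exprD cardsT -(cardsC U) addnAC addnn.
  by rewrite exprD -mul2n exprM sqrrN !expr1n mul1r.
by rewrite subUset subsetT andbT.
Qed.
End Moebius.

Lemma Fcoef_sub n (S : {set 'I_n.-1}) w : Fcoef S w = (S \subset ascents n w).
Proof.
by apply/forall_inP/subsetP => H i /H; rewrite inE.
Qed.

(** Complementation reverses inclusion, and [rev_ord] is an involution, so the reversal moves onto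
    [D]. This brings $\omega$ into the form of [sum_moebius_sup]. *)
Lemma omega_set_sub n (S D : {set 'I_n.-1}) :
  (omega_set S \subset D) = (~: [set rev_ord i | i in D] \subset S).
Proof.
have mem_rev (A : {set 'I_n.-1}) i : (i \in [set rev_ord j | j in A]) = (rev_ord i \in A).
  by rewrite -{1}(rev_ordK i) mem_imset //; exact: rev_ord_inj.
apply/subsetP/subsetP => H i; have := H (rev_ord i);
  rewrite !inE !mem_rev ?rev_ordK; exact: contraR.
Qed.

Lemma setalgZE (n : nat) (E : seq ('I_n * 'I_n)) (c : rat) (f : setalg E) V :
  (c *: f) V = c%:P * f V.
Proof. by rewrite ffunE -mul_polyC. Qed.

Lemma sum_setalgE (n : nat) (E : seq ('I_n * 'I_n)) (I : Type) (r : seq I) (P : pred I)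
  (F : I -> setalg E) V : (\sum_(i <- r | P i) F i) V = \sum_(i <- r | P i) F i V.
Proof. by rewrite sum_ffunE. Qed.

(** * Two expansions of products of the $h_k$, and the coefficients $c_\alpha$ *)

Section Expansions.
Variables (n : nat) (E : seq ('I_n * 'I_n)).
Local Notation h := (fun k => grade k (htot E)).
Local Notation g := (fun k => grade k (gtot E)).

Lemma rprod_htot_elem m b : b \in compositions m ->
  \sum_(a <- compositions m | comp_le a b) (-1) ^+ (m - size a) *: rprod (elem E) a
  = rprod h b.
Proof.
(* Writing the sign with [sumn a] instead of [m] makes it a function of the list alone,
   multiplicative under concatenation. *)
move=> hb; rewrite -(@sum_refinements _ _ (fun a _ => (-1) ^+ (sumn a - size a))
  (fun a => (-1) ^+ (sumn a - size a)) (elem E) h _ _ _ m b hb) //.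
- rewrite big_seq_cond [RHS]big_seq_cond; apply: eq_bigr => a /andP[ha _].
  by rewrite (compositions_sum ha).
- move=> k p a1 a c _ ha1 ha _; rewrite -exprD; congr (_ ^+ _).
  rewrite sumn_cat size_cat (compositions_sum ha1) (compositions_sum ha).
  by have := size_compositions ha1; have := size_compositions ha;
    move: (size a) (size a1) => s s1; lia.
- move=> k _.
  apply: (etrans (homogeneous_elementary (h := h) (grade_htot0 E) (grade_htot_elem E) k)).
  by apply: eq_big_seq => a ha; rewrite (compositions_sum ha).
Qed.

Lemma rprod_htot_gtot m b : b \in compositions m ->
  \sum_(a <- compositions m | comp_le a b) (pi2 a b)%:R^-1 *: rprod g a
  = rprod h b.
Proof.
move=> hb; apply: (@sum_refinements _ _ (fun a c => (pi2 a c)%:R^-1)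
  (fun a => (pi1 a)%:R^-1) g h _ _ _ m b hb).
- by rewrite pi2_nil invr1.
- move=> k p a1 a c k0 ha1 ha _.
  rewrite pi2_cat ?(compositions_pos ha1) ?(compositions_pos ha) ?(compositions_sum ha1) //.
  by rewrite natrM invfM.
- by move=> k _; apply: (homogeneous_power (h := h) (g := g) (grade_htot0 E) (grade_htot_gtot E)).
Qed.

End Expansions.

Theorem theorem7p3 (n : nat) (E : seq ('I_n * 'I_n)) (hE : loopless E) :
  exists (d : {set 'I_n.-1} -> {poly rat}) (c : seq nat -> {poly rat}),
    [/\ (* X_G = sum_S d_S F_{n,S} *)
        (forall w, is_mono n w ->
           XGcoef E w = \sum_(S : {set 'I_n.-1}) d S * (Fcoef S w)%:R),
        (* omega X_G = sum_alpha c_alpha Psi_alpha / z_alpha *)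
        (forall w, is_mono n w ->
           \sum_(S : {set 'I_n.-1}) d S * (Fcoef (omega_set S) w)%:R =
           \sum_(a <- compositions n) c a * (Psicoef n a w / (zee a)%:R)%:P) &
        (* c_alpha in N[q] *)
        (forall a, a \in compositions n -> forall i, (c a)`_i \is a Num.nat)].
Proof.
(* By [XGcoefE] a coefficient depends only on the type, so [f U] is the coefficient at every
   monomial with ascent set [U]. *)
pose f (U : {set 'I_n.-1}) := XGcoef E (word U).
have fE a : a \in compositions n -> f (cset n a) = rprod (elem E) (rev a) setT.
  by move=> ha; rewrite /f XGcoefE ?word_mono // wtype_word.
(* The expansion in fundamentals reads [f D] as the sum of the [d S] over [S \subset D], which
   forces [d] to be [moebius f]. *)
exists (moebius f), (fun a => rprod (fun k => grade k (gtot E)) a setT).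
split=> [w mw|w mw|a _ i]; last by apply/polyOverP/rprod_nat.
- rewrite XGcoefE // -(fE _ (wtype_compositions mw)) cset_wtype // -sum_moebius_sub.
  rewrite big_mkcond; apply: eq_bigr => S _.
  by rewrite Fcoef_sub; case: ifP; rewrite ?mulr1 ?mulr0.
have hw := wtype_compositions mw.
(* Both sides equal the product of the $h_k$ over the type of [w], expanded in stable sets on one
   side and in unique-sink orientations on the other. *)
transitivity (rprod (fun k => grade k (htot E)) (wtype w) setT).
  rewrite -(rprod_htot_elem E hw) sum_setalgE.
  set D := ascents n w.
  transitivity (\sum_(S : {set 'I_n.-1} | ~: [set rev_ord i | i in D] \subset S) moebius f S).
    rewrite [RHS]big_mkcond; apply: eq_bigr => S _.
    by rewrite Fcoef_sub omega_set_sub; case: ifP; rewrite ?mulr1 ?mulr0.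
  have rK : involutive (fun T : {set 'I_n.-1} => [set rev_ord i | i in T]).
    move=> T; rewrite -imset_comp -[RHS]imset_id; apply: eq_imset => i /=; exact: rev_ordK.
  (* Summing over reversed sets removes the reversal from the inclusion and moves it into the
     argument of [f]. *)
  rewrite sum_moebius_sup (reindex_inj (inv_inj rK)) big_mkcond sum_cset [RHS]big_mkcond.
  apply: eq_big_seq => a ha; rewrite (comp_le_cset ha hw) cset_wtype // -/D.
  have -> : ([set rev_ord i | i in D] \subset [set rev_ord i | i in cset n a]) =
            (D \subset cset n a).
    apply/idP/idP; last exact: imsetS.
    by move/(imsetS (@rev_ord n.-1)); rewrite !rK.
  (* The reversal from $\omega$ cancels the [rev] in [fE], so the stable-set factors come out in the
     order of [rprod]. *)
  rewrite -cset_rev // fE ?rev_compositions // revK.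
  rewrite card_setC_cset ?rev_compositions // size_rev.
  by case: ifP => // _; rewrite setalgZE rmorphXn rmorphN1.
rewrite -(rprod_htot_gtot E hw) sum_setalgE big_mkcond; apply: eq_big_seq => a ha.
rewrite PsicoefE //; case: ifP => _; last by rewrite mulr0.
by rewrite setalgZE mulrC.
Qed.
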